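(* Let $X$ be a real Banach space, let $f: X \to \mathbb{R}\cup\{+\infty\}$ be a proper lower semicontinuous convex function and let $\ell\geq 0$. Then the following three statements are equivalent: (i) $f$ is $\ell$-Lipschitz on $\operatorname{dom}f$; (a) $\emptyset\neq\partial f(x) \subset N_{\ell}(x; \operatorname{dom}f)$ for all $x\in\operatorname{dom}f$; (b) $\partial f(x) \cap N_{\ell}(x; \operatorname{dom}f)\neq\emptyset$ for all $x\in\operatorname{dom}f$.
   Context: $X^*$ is the continuous dual of $X$ with its dual norm. For $f:X\to\mathbb{R}\cup\{+\infty\}$, $\operatorname{dom}f=\{x\in X: f(x)\in\mathbb{R}\}$; $f$ is proper if $\operatorname{dom} f\neq\emptyset$, convex (resp. lower semicontinuous) if its epigraph $\{(x,r)\in X\times\mathbb{R}: f(x)\le r\}$ is convex (resp. closed in $X\times\mathbb{R}$). For a nonempty set $S\subset X$, $f$ is $\ell$-Lipschitz on $S$ if $f$ is finite on $S$ and $|f(x)-f(y)|\le \ell\|x-y\|$ for all $x,y\in S$. The subdifferential of $f$ at $x$ with $f(x)$ finite is $\partial f(x)=\{x^*\in X^*: f(y)-f(x)\ge\langle x^*,y-x\rangle\ \forall y\in X\}$. For a nonempty convex set $\Omega\subset X$, $x\in\Omega$ and $\varepsilon\ge 0$, the set of $\varepsilon$-normals to $\Omega$ at $x$ is $N_\varepsilon(x;\Omega)=\{x^*\in X^*:\langle x^*, y-x\rangle\leq\varepsilon\|y-x\|\text{ for all } y\in \Omega\}$. *)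

(* Defs.v *)
From HB Require Import structures.
From mathcomp Require Import all_boot all_order all_algebra.
From mathcomp Require Import all_classical all_reals all_analysis.

Set Implicit Arguments.
Unset Strict Implicit.
Unset Printing Implicit Defensive.

Import Order.TTheory GRing.Theory Num.Theory.
Import numFieldNormedType.Exports.

Local Open Scope classical_set_scope.
Local Open Scope ring_scope.

(* Functions X -> R U {+oo} are rendered as f : X -> \bar R together with the
   hypothesis that f never takes the value -oo. *)

Record dual (R : realType) (X : normedModType R) := Dual {
  dual_form :> {linear X -> R^o};
  dual_continuous : continuous dual_form
}.

Section extended_real_functions.
Context {R : realType} {X : normedModType R}.
Implicit Types (f : X -> \bar R) (S Omega : set X) (x : X) (l eps : R).

Definition dom f : set X := [set x | f x \is a fin_num].

Definition proper_fun f := dom f !=set0.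

Definition epigraph f : set (X * R^o) := [set xr | (f xr.1 <= xr.2%:E)%E].

Definition convex_efun f :=
  convex_set (epigraph f : set (convex_lmodType (X * R^o)%type)).

Definition lsc_efun f := closed (epigraph f).

Definition elipschitz l S f :=
  (forall x, S x -> f x \is a fin_num) /\ l.-lipschitz_S (fine \o f : X -> R^o).

(* Meaningful for f x finite; if f x = +oo the set is empty, since
   f y - +oo = -oo for every y. *)
Definition subdifferential f x : set (dual X) :=
  [set xs | forall y, ((xs (y - x))%:E <= f y - f x)%E].

Definition eps_normals eps x Omega : set (dual X) :=
  [set xs | forall y, Omega y -> xs (y - x) <= eps * `|y - x|].

End extended_real_functions.

(* Main.v *)
Require Import Defs.
From HB Require Import structures.
From mathcomp Require Import all_boot all_order all_algebra.
From mathcomp Require Import all_classical all_reals all_analysis.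
From mathcomp Require Import lra.

Set Implicit Arguments.
Unset Strict Implicit.
Unset Printing Implicit Defensive.

Import Order.TTheory GRing.Theory Num.Theory.
Import numFieldNormedType.Exports.

Local Open Scope classical_set_scope.
Local Open Scope ring_scope.

(** Call (i) the Lipschitz property, (a) the property that subgradients exist
    and are all l-normals, (b) the existence of l-normal subgradients.  From
    (a) to (b) there is nothing to do.

    From (b) to (i), fix x, y in dom f and put z = x + t(y - x) with
    0 < t < 1.  Since y - z is a positive multiple of y - x, a subgradient zs
    at z that is an l-normal satisfies <zs, y - x> <= l |y - x|, and the
    subgradient inequality at z, tested at x, gives
    f z - f x <= t <zs, y - x> <= t l |y - x|.  This does not reach y itself; a
    subgradient ys at y gives f y - f z <= (1 - t) <ys, y - x>, which vanishes
    as t tends to 1.  Adding the two bounds and letting t tend to 1 yields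
    f y - f x <= l |y - x| (normal_subgradients_lipschitz).

    From (i) to (a), a subgradient xs satisfies
    <xs, y - x> <= f y - f x <= l |y - x| on the domain, hence is an l-normal.
    For existence, consider
      p v = inf { t (f z - f x) + l |v - t (z - x)| : t > 0, z in dom f }.
    The Lipschitz bound makes it finite, convexity of f makes it sublinear,
    and p v <= l |v| and p (z - x) <= f z - f x.  So any linear form below p
    is continuous and is a subgradient of f at x
    (subdifferential_nonempty).

    A linear form below p (linear_below_sublinear) is a minimal element,
    provided by Zorn's lemma, of the set of sublinear functions below p.
    Minimality forces linearity
    because q v can be lowered to inf_{t >= 0} (q (v + t y) - t q y), again
    sublinear: minimality makes the two equal, and t = 1 gives
    q v + q y <= q (v + y). *)

(** * Sublinear functions and dominated linear forms *)

Section sublinear.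
Context {R : realType} {V : lmodType R}.
Implicit Types (p q : V -> R) (u v y : V).

(** Homogeneity is required only as an inequality: applying it to t^-1 gives
    the converse one. *)
Definition sublinear q :=
  (forall u v, q (u + v) <= q u + q v) /\
  (forall (t : R) v, 0 < t -> q (t *: v) <= t * q v).

Lemma sublinear0 q : sublinear q -> q 0 = 0.
Proof.
move=> [qD qZ]; have := qD 0 0; rewrite addr0 => h1.
have := qZ 2^-1 0 ltac:(by rewrite invr_gt0); rewrite scaler0 => h2.
by lra.
Qed.

Lemma sublinearN q v : sublinear q -> - q (- v) <= q v.
Proof.
by move=> qs; have := qs.1 v (- v); rewrite subrr sublinear0// => ?; lra.
Qed.

Lemma sublinearZ q t v : sublinear q -> 0 <= t -> q (t *: v) = t * q v.
Proof.
move=> qs; rewrite le_eqVlt => /predU1P[<-|t0].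
  by rewrite scale0r mul0r sublinear0.
apply/eqP; rewrite eq_le qs.2//=.
have := qs.2 t^-1 (t *: v) ltac:(by rewrite invr_gt0).
rewrite scalerA mulVf ?gt_eqF// scale1r => h.
by rewrite -(ler_pM2l (x := t^-1)) ?invr_gt0// mulrA mulVf ?gt_eqF// mul1r.
Qed.

(** The sets S v are the vertical slices of a subset of V * R which, once
    closed upwards, is a convex cone by the last two hypotheses; so the
    function that bounds it from below is sublinear.  The infimum of a chain,
    the lowering of a sublinear function and the directional bound on a
    Lipschitz function are three instances. *)
Lemma sublinear_inf (S : V -> set R) :
  (forall v, has_inf (S v)) ->
  (forall u v a b, S u a -> S v b -> exists2 c, S (u + v) c & c <= a + b) ->
  (forall (t : R) v a, 0 < t -> S v a -> exists2 c, S (t *: v) c & c <= t * a) ->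
  sublinear (fun v => inf (S v)).
Proof.
move=> Sinf SD SZ; split=> /= [u v|t v t0].
- rewrite -lerBlDr; apply: lb_le_inf => [|a Sa]; first exact: (Sinf u).1.
  rewrite lerBlDr -lerBlDl.
  apply: lb_le_inf => [|b Sb]; first exact: (Sinf v).1.
  have [c Sc cab] := SD _ _ _ _ Sa Sb.
  by rewrite lerBlDl (le_trans _ cab)// ge_inf//; exact: (Sinf _).2.
- rewrite -ler_pdivrMl//; apply: lb_le_inf => [|a Sa]; first exact: (Sinf v).1.
  rewrite ler_pdivrMl//; have [c Sc cta] := SZ _ _ _ t0 Sa.
  by rewrite (le_trans _ cta)// ge_inf//; exact: (Sinf _).2.
Qed.

(** The pointwise infimum of a chain is sublinear: two members of the chain
    can be replaced by the smaller one.  It is finite because - p (- v) bounds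
    every sublinear function below p from below. *)
Lemma sublinear_chain_lbound p (A : set (V -> R)) : sublinear p ->
  (forall q, A q -> sublinear q /\ forall v, q v <= p v) ->
  (forall q r, A q -> A r ->
    (forall v, q v <= r v) \/ (forall v, r v <= q v)) ->
  exists2 q, sublinear q /\ (forall v, q v <= p v) &
    forall r, A r -> forall v, q v <= r v.
Proof.
move=> ps Ap Atot; have [A0|/set0P[q0 Aq0]] := eqVneq A set0.
  by exists p => // r; rewrite A0.
pose S v := [set q v | q in A].
have Sinf v : has_inf (S v).
  split; first by exists (q0 v), q0.
  exists (- p (- v)) => _ [q Aq <-]; have [qs qp] := Ap _ Aq.
  by rewrite (le_trans _ (sublinearN _ qs))// lerN2.
have infS r v : A r -> inf (S v) <= r v.
  by move=> Ar; apply: ge_inf; [exact: (Sinf v).2|exists r].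
exists (fun v => inf (S v)); last by move=> r Ar v; exact: infS.
split; last by move=> v; rewrite (le_trans (infS _ _ Aq0))// (Ap _ Aq0).2.
apply: sublinear_inf => // [u v _ _ [q Aq <-] [r Ar <-]|t v _ t0 [q Aq <-]].
- have [qr|rq] := Atot _ _ Aq Ar.
  + exists (q (u + v)); first by exists q.
    by rewrite (le_trans ((Ap _ Aq).1.1 _ _))// lerD2l.
  + exists (r (u + v)); first by exists r.
    by rewrite (le_trans ((Ap _ Ar).1.1 _ _))// lerD2r.
- by exists (q (t *: v)); [exists q|exact: (Ap _ Aq).1.2].
Qed.

Lemma sublinear_minimal p : sublinear p ->
  exists2 q, sublinear q /\ (forall v, q v <= p v) &
    forall r, sublinear r -> (forall v, r v <= q v) -> forall v, q v <= r v.
Proof.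
move=> ps; pose T := {q | sublinear q /\ forall v, q v <= p v}.
pose ge (a b : T) := `[< forall v, sval b v <= sval a v >].
have p0 : T by exists p; split.
have [a||A Atot|[q [qs qp]] qmin] := @ZL_preorder T p0 ge.
- exact/asboolP.
- move=> a b c /asboolP ba /asboolP cb; apply/asboolP => v.
  exact: le_trans (cb v) (ba v).
- have [||q qP qle] := @sublinear_chain_lbound p [set sval a | a in A] ps.
  + by move=> _ [a _ <-]; exact: svalP a.
  + move=> _ _ [a Aa <-] [b Ab <-].
    by have [/asboolP|/asboolP] := Atot _ _ Aa Ab; [right|left].
  + exists (exist _ q qP) => a Aa; apply/asboolP => v /=.
    by apply: qle; exists a.
- exists q => // r rs rq v.
  have rP : sublinear r /\ forall v, r v <= p v.
    by split=> // w; exact: le_trans (rq w) (qp w).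
  have /asboolP := qmin (exist _ r rP) ltac:(exact/asboolP).
  exact.
Qed.

(** The candidate for a smaller sublinear function: at - y it is at most
    - q y, hence smaller than q as soon as - q y < q (- y). *)
Definition lowered q y v := inf [set q (v + t *: y) - t * q y | t in >= 0].

Lemma lowered_has_inf q y v : sublinear q ->
  has_inf [set q (v + t *: y) - t * q y | t in >= 0].
Proof.
move=> qs; split; first by exists (q (v + 0 *: y) - 0 * q y), 0 => /=.
exists (- q (- v)) => _ [t /= t0 <-].
have := qs.1 (v + t *: y) (- v).
by rewrite addrAC subrr add0r sublinearZ// => ?; lra.
Qed.

Lemma lowered_le q y v t : sublinear q -> 0 <= t ->
  lowered q y v <= q (v + t *: y) - t * q y.
Proof.
move=> qs t0; apply: ge_inf; last by exists t.
by have [] := lowered_has_inf y v qs.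
Qed.

Lemma sublinear_lowered q y : sublinear q -> sublinear (lowered q y).
Proof.
move=> qs; apply: sublinear_inf => [v|u v _ _ [s /= s0 <-] [t /= t0 <-]|].
- exact: lowered_has_inf.
- exists (q (u + v + (s + t) *: y) - (s + t) * q y).
    by exists (s + t) => //=; exact: addr_ge0.
  have := qs.1 (u + s *: y) (v + t *: y).
  by rewrite addrACA -scalerDl => ?; lra.
- move=> s v _ s0 [t /= t0 <-].
  exists (q (s *: v + (s * t) *: y) - (s * t) * q y).
    by exists (s * t) => //=; rewrite mulr_ge0// ltW.
  by rewrite -scalerA -scalerDr (sublinearZ _ qs (ltW s0)) mulrBr mulrA.
Qed.

(** A minimal q equals its own lowering in the direction v; the value t = 1
    then bounds q u by q (u + v) - q v. *)
Lemma minimal_sublinearD q : sublinear q ->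
  (forall r, sublinear r -> (forall v, r v <= q v) -> forall v, q v <= r v) ->
  forall u v, q (u + v) = q u + q v.
Proof.
move=> qs qmin u v; apply/eqP; rewrite eq_le qs.1 /= -lerBrDr.
have le1 w : lowered q v w <= q w.
  by have := lowered_le v w qs (lexx 0); rewrite scale0r mul0r addr0 subr0.
rewrite (le_trans (qmin _ (sublinear_lowered v qs) le1 u))//.
by have := lowered_le v u qs ler01; rewrite scale1r mul1r.
Qed.

(** The form of the Hahn-Banach theorem in which the subspace is zero. *)
Lemma linear_below_sublinear p : sublinear p ->
  exists h : {linear V -> R^o}, forall v, h v <= p v.
Proof.
move=> /sublinear_minimal[q [qs qp] qmin].
have qD := minimal_sublinearD qs qmin.
have qN v : q (- v) = - q v.
  by apply/eqP; rewrite -addr_eq0 addrC -qD subrr sublinear0.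
have qlin : linear (q : V -> R^o).
  move=> a u v; rewrite qD; congr (_ + _).
  have [a0|/ltW a0] := leP 0 a; first exact: sublinearZ.
  rewrite -[a *: u]opprK qN -scaleNr sublinearZ ?oppr_ge0//.
  by rewrite mulNr opprK.
pose h : {linear V -> R^o} :=
  HB.pack (q : V -> R^o) (GRing.isLinear.Build _ _ _ _ _ qlin).
by exists h.
Qed.

End sublinear.

(** A one-sided bound is enough, since h (- v) = - h v. *)
Lemma linear_le_norm_continuous {R : realType} {X : normedModType R} (l : R)
    (h : {linear X -> R^o}) :
  (forall v, h v <= l * `|v|) -> continuous h.
Proof.
move=> hl; apply: bounded_linear_continuous; apply/linear_boundedP.
near=> r => v; have lr : l * `|v| <= r * `|v| by rewrite ler_wpM2r.
rewrite ler_norml (le_trans (hl v) lr) andbT lerNl -linearN.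
by rewrite (le_trans (hl _))// normrN.
Unshelve. all: by end_near. Qed.

(** * Extended-real convex functions *)

Section efun.
Context {R : realType} {X : normedModType R}.
Variables (f : X -> \bar R) (l : R).
Hypotheses (f_gtNy : forall x : X, f x <> -oo%E) (f_convex : convex_efun f).

(** Exchanging x and y turns the one-sided estimate into the bound on the
    absolute value. *)
Lemma elipschitzP : (forall x y, dom f x -> dom f y ->
    fine (f y) - fine (f x) <= l * `|y - x|) <-> elipschitz l (dom f) f.
Proof.
split=> [H|[_ H] x y fx fy]; last first.
  exact: le_trans (ler_norm _) (H (y, x) (conj fy fx)).
split=> // -[x y] [/= fx fy]; rewrite ler_norml H// andbT lerNl opprB.
by rewrite distrC H.
Qed.

(** Outside the domain f is +oo, and the subgradient inequality is trivial. *)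
Lemma subdifferentialP x (xs : dual X) : dom f x ->
  subdifferential f x xs <->
  forall y, dom f y -> xs (y - x) <= fine (f y) - fine (f x).
Proof.
move=> fx; split=> [H y fy|H y].
  by have := H y; rewrite -(fineK fx) -(fineK fy) -EFinB lee_fin.
have [fy|] := boolP (f y \is a fin_num).
  by rewrite -(fineK fx) -(fineK fy) -EFinB lee_fin H.
have := @f_gtNy y; case: (f y) => // _ _.
by rewrite -(fineK fx) addye ?leey.
Qed.

Lemma convex_efunP x y t : dom f x -> dom f y -> 0 <= t -> t <= 1 ->
  dom f (t *: x + (1 - t) *: y) /\
  fine (f (t *: x + (1 - t) *: y)) <= t * fine (f x) + (1 - t) * fine (f y).
Proof.
move=> fx fy t0 t1.
have t01 : Itv.spec (@Itv.num_sem R) (Itv.Real `[0%Z, 1%Z]) t.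
  by rewrite /= /Itv.num_sem /= in_itv /= t0 t1 !andbT ger0_real.
have ex z : dom f z -> ((z, fine (f z)) : X * R^o) \in epigraph f.
  by move=> fz; rewrite inE /epigraph /= fineK.
have := f_convex (Itv.mk t01) (ex _ fx) (ex _ fy).
rewrite inE /epigraph /= => H.
set z := t *: x + (1 - t) *: y.
have {}H : (f z <= (t * fine (f x) + (1 - t) * fine (f y))%:E)%E := H.
have fz : dom f z.
  by move: H (@f_gtNy z); rewrite /dom /=; case: (f z).
by split=> //; rewrite -lee_fin fineK.
Qed.

(** * From Lipschitz continuity to subgradients *)

Section subgradient.
Variable x : X.
Hypotheses (fx : dom f x)
  (f_lip : forall x y, dom f x -> dom f y ->
    fine (f y) - fine (f x) <= l * `|y - x|) (l_ge0 : 0 <= l).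

(** The infimum of these values is the directional derivative at x, in the
    direction v, of the largest l-Lipschitz function below f, namely
    w |-> inf_z (f z + l |w - z|): they are its difference quotients at
    x + t^-1 v, before the infimum over z is taken. *)
Definition slopes v := [set a | exists (t : R) z, [/\ 0 < t, dom f z &
  a = t * (fine (f z) - fine (f x)) + l * `|v - t *: (z - x)|]].

(** The Lipschitz bound at z costs at most l |t (z - x)|, which the triangle
    inequality recovers from the penalty up to l |v|. *)
Lemma slopes_has_inf v : has_inf (slopes v).
Proof.
split; first by do 2!eexists; exists x; split; [exact: ltr01|exact: fx|].
exists (- (l * `|v|)) => _ [t [z [t0 fz ->]]].
have := f_lip fz fx; rewrite -(ler_pM2l t0) distrC.
rewrite [X in _ <= X]mulrCA -{2}(gtr0_norm t0) -normrZ => h1.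
have : l * `|t *: (z - x)| <= l * `|v| + l * `|v - t *: (z - x)|.
  by rewrite -mulrDr ler_wpM2l// -[X in `|X|](subKr v) ler_normB.
by lra.
Qed.

Lemma sublinear_slopes : sublinear (fun v => inf (slopes v)).
Proof.
apply: sublinear_inf => [||t v _ t0 [s [z [s0 fz ->]]]].
- exact: slopes_has_inf.
- move=> u v _ _ [s [z [s0 fz ->]]] [t [w [t0 fw ->]]].
  have st0 : 0 < s + t by exact: addr_gt0.
  (* The weights a and 1 - a are those for which the combination m of z and w
     satisfies (s + t) (m - x) = s (z - x) + t (w - x). *)
  pose a := s / (s + t).
  have sta : (s + t) * a = s by rewrite mulrC divfK ?gt_eqF.
  have stb : (s + t) * (1 - a) = t by rewrite mulrBr sta mulr1 addrC addKr.
  have a0 : 0 <= a by rewrite divr_ge0// ltW.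
  have a1 : a <= 1 by rewrite ler_pdivrMr// mul1r lerDl ltW.
  clearbody a; have [fm fmle] := convex_efunP fz fw a0 a1.
  set m := a *: z + (1 - a) *: w in fm fmle.
  have mE : (s + t) *: (m - x) = s *: (z - x) + t *: (w - x).
    rewrite /m scalerBr scalerDr !scalerA sta stb !scalerBr scalerDl.
    by rewrite opprD addrACA.
  exists ((s + t) * (fine (f m) - fine (f x)) +
          l * `|u + v - (s + t) *: (m - x)|); first by exists (s + t), m.
  have nle : l * `|u + v - (s + t) *: (m - x)| <=
      l * `|u - s *: (z - x)| + l * `|v - t *: (w - x)|.
    by rewrite -mulrDr ler_wpM2l// mE opprD addrACA ler_normD.
  have : (s + t) * fine (f m) <= s * fine (f z) + t * fine (f w).
    by rewrite -(ler_pM2l st0) mulrDr !mulrA sta stb in fmle.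
  by lra.
- exists (t * s * (fine (f z) - fine (f x)) +
          l * `|t *: v - (t * s) *: (z - x)|).
    by exists (t * s), z; split=> //; exact: mulr_gt0.
  rewrite -scalerA -scalerBr normrZ gtr0_norm//.
  by lra.
Qed.

Lemma inf_slopes_le v t z : 0 < t -> dom f z ->
  inf (slopes v) <= t * (fine (f z) - fine (f x)) + l * `|v - t *: (z - x)|.
Proof.
move=> t0 fz; apply: ge_inf; first exact: (slopes_has_inf v).2.
by exists t, z.
Qed.

Lemma subdifferential_nonempty : subdifferential f x !=set0.
Proof.
have [h hp] := linear_below_sublinear sublinear_slopes.
have hc : continuous h.
  apply: (@linear_le_norm_continuous _ _ l) => v; apply: le_trans (hp v) _.
  have := inf_slopes_le v ltr01 fx.
  by rewrite !subrr scaler0 subr0 mulr0 add0r.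
exists (Dual hc); apply/subdifferentialP => // y fy /=.
apply: le_trans (hp _) _.
have := inf_slopes_le (y - x) ltr01 fy.
by rewrite scale1r subrr normr0 mulr0 addr0 mul1r.
Qed.

Lemma subdifferential_sub_normals :
  subdifferential f x `<=` eps_normals l x (dom f).
Proof.
move=> xs /(subdifferentialP _ fx) H y fy.
exact: le_trans (H y fy) (f_lip fx fy).
Qed.

End subgradient.

(** * From normal subgradients to Lipschitz continuity *)

Lemma le_of_convex_combinations (a b c : R) :
  (forall t, 0 < t < 1 -> b <= (1 - t) * a + t * c) -> b <= c.
Proof.
move=> H; rewrite leNgt; apply/negP => cb.
(* With this s, the excess s (a - c) over c is at most half of b - c. *)
pose s := (b - c) / (2 * (`|a - c| + (b - c))).
have d0 : 0 < 2 * (`|a - c| + (b - c)).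
  by rewrite mulr_gt0// ltr_wpDl// subr_gt0.
have sE : s * (2 * (`|a - c| + (b - c))) = b - c.
  by rewrite divfK// gt_eqF.
have s0 : 0 < s by rewrite divr_gt0// subr_gt0.
have s1 : s < 1.
  rewrite ltr_pdivrMr// mul1r; have := normr_ge0 (a - c); lra.
have := H (1 - s) ltac:(by apply/andP; split; lra).
have : s * (a - c) <= s * `|a - c| by rewrite ler_pM2l// ler_norm.
have : 0 < s * (b - c) by rewrite mulr_gt0// subr_gt0.
by lra.
Qed.

(** Normality controls zs only in the direction of y, so it is used at a point
    z strictly between x and y; the subgradient at y, of which
    no bound in terms of l is known, serves only to let z tend to y. *)
Lemma normal_subgradients_lipschitz :
  (forall x, dom f x -> subdifferential f x `&` eps_normals l x (dom f) !=set0) ->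
  forall x y, dom f x -> dom f y -> fine (f y) - fine (f x) <= l * `|y - x|.
Proof.
move=> H x y fx fy.
have [ys [/(subdifferentialP _ fy) ysf _]] := H y fy.
apply: (@le_of_convex_combinations (ys (y - x))) => t /andP[t0 t1].
have [fz _] := convex_efunP fy fx (ltW t0) (ltW t1).
set z := t *: y + (1 - t) *: x in fz.
have zE : z = x + t *: (y - x) by rewrite /z scalerBl scale1r scalerBr addrCA.
have zx : x - z = - t *: (y - x).
  by rewrite zE opprD addrA subrr add0r scaleNr.
have yz : y - z = (1 - t) *: (y - x).
  by rewrite zE opprD addrA scalerBl scale1r.
have [zs [/(subdifferentialP _ fz) zsf zsn]] := H z fz.
have := zsf x fx; rewrite zx linearZ /= => h1.
have := zsn y fy; rewrite yz linearZ /= normrZ gtr0_norm ?subr_gt0//.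
rewrite [X in _ <= X]mulrCA ler_pM2l ?subr_gt0// => h2.
have := ysf z fz; rewrite -[z - y]opprB yz -scaleNr linearZ /= => h3.
have : t * zs (y - x) <= t * (l * `|y - x|) by rewrite ler_pM2l.
move: h1 h3; rewrite /GRing.scale /=.
by lra.
Qed.

End efun.

Theorem corollary3p2 (R : realType) (X : completeNormedModType R)
    (f : X -> \bar R) (l : R)
    (f_gtNy : forall x : X, f x <> -oo%E)
    (f_proper : proper_fun f)
    (f_lsc : lsc_efun f)
    (f_convex : convex_efun f)
    (l_ge0 : 0 <= l) :
  [<-> elipschitz l (dom f) f;
       forall x : X, dom f x ->
         subdifferential f x !=set0 /\
         subdifferential f x `<=` eps_normals l x (dom f);
       forall x : X, dom f x ->
         subdifferential f x `&` eps_normals l x (dom f) !=set0].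
Proof.
tfae.
- move=> /elipschitzP f_lip x fx; split.
    exact: (subdifferential_nonempty f_gtNy f_convex fx f_lip l_ge0).
  exact: subdifferential_sub_normals.
- move=> H x fx; have [[xs xsf] sub] := H x fx.
  by exists xs; split=> //; exact: sub.
- by move=> H; apply/elipschitzP; exact: normal_subgradients_lipschitz.
Qed.
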